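(* Let $\ell\le u$ be real numbers, let $\nu$ be a positive integer, and let $\theta_{min},\theta_d$ be the angles defined in the context. For fixed $z=(z_1,\dots,z_\nu)\in\{0,1\}^\nu$ and $(x,y)\in\mathbb{R}^2$, there exists $\{\xi_j,\eta_j,\lambda_{j,1},\lambda_{j,2}\}_{j=1}^\nu$ such that $\left(x,y,\{\xi_j,\eta_j,\lambda_{j,1},\lambda_{j,2},z_j\}_{j=1}^\nu\right)$ is feasible for the system (MIP-D) if and only if $$(x,y)\in\Delta_{\phi(z),\beta(z)},$$ where $$\phi(z):=\theta_{min}+\sum_{i=0}^{\nu-1}\left[(-1)^{\sum_{j=1}^{i}(1-z_j)}\right]\frac{\theta_d}{2^{i+1}},\qquad \beta(z):=\phi(z)+(-1)^s\frac{\theta_d}{2^\nu},\qquad s:=\sum_{j=1}^{\nu}(1-z_j)$$ (with the convention $\sum_{j=1}^{0}(1-z_j)=0$). Furthermore, there exists $\{\xi_j,\eta_j,\lambda_{j,1},\lambda_{j,2}\}_{j=1}^\nu$ such that $\left(x,y,\{\xi_j,\eta_j,\lambda_{j,1},\lambda_{j,2},z_j\}_{j=1}^\nu\right)$ is feasible for the system (MIP-D$^+$) if and only if $$(x,y)\in\Delta^+_{\phi(z),\beta(z)}.$$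
   Context: Let $B_{[\ell,u]}=\{(x,y)\in\mathbb{R}^2 : x\in[\ell,u],\ 0\le y\le(\ell+u)x-\ell u\}$. Angles. For $t\in\mathbb{R}$ put $\Theta(t)=\arctan\frac{t^2-1}{2t}$ if $t>0$, $\Theta(0)=-\frac{\pi}{2}$, and $\Theta(t)=\arctan\frac{t^2-1}{2t}-\pi$ if $t<0$, where $\arctan$ takes values in $(-\frac\pi2,\frac\pi2)$. Let $\theta_{min}=\Theta(\ell)$, $\theta_{max}=\Theta(u)$, $\theta_{mid}=(\theta_{min}+\theta_{max})/2$, $\theta_d=\theta_{max}-\theta_{min}$. Let $C=\max(\ell^2,u^2)/2+0.5$ and $C_j=C\sin(\theta_d/2^{j+1})$ for $j=1,\dots,\nu$. Constraints, with real variables $x,y,\xi_j,\eta_j,\lambda_{j,1},\lambda_{j,2}$ and binary $z_j\in\{0,1\}$ ($j=1,\dots,\nu$): (a) $\xi_1=x\cos(\theta_{mid})+(y/2-0.5)\sin(\theta_{mid})$; $(\lambda_{1,2}-\lambda_{1,1})C=-x\sin(\theta_{mid})+(y/2-0.5)\cos(\theta_{mid})$; $\eta_1=(\lambda_{1,1}+\lambda_{1,2})C$; $0\le\lambda_{1,1}\le1-z_1$; $0\le\lambda_{1,2}\le z_1$. (b) for $j=1,\dots,\nu-1$: $\xi_{j+1}=\xi_j\cos(\theta_d/2^{j+1})+\eta_j\sin(\theta_d/2^{j+1})$; $(\lambda_{j+1,2}-\lambda_{j+1,1})C_j=-\xi_j\sin(\theta_d/2^{j+1})+\eta_j\cos(\theta_d/2^{j+1})$;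 $\eta_{j+1}=(\lambda_{j+1,1}+\lambda_{j+1,2})C_j$; $0\le\lambda_{j+1,1}\le1-z_{j+1}$; $0\le\lambda_{j+1,2}\le z_{j+1}$. (c) $\xi_\nu\cos\left(\frac{\theta_d}{2^{\nu+1}}\right)+\eta_\nu\sin\left(\frac{\theta_d}{2^{\nu+1}}\right)\ge\frac{y+1}{2}\cos\left(\frac{\theta_d}{2^{\nu+1}}\right)$. (d) $\xi_\nu\cos\left(\frac{\theta_d}{2^{\nu}}\right)+\eta_\nu\sin\left(\frac{\theta_d}{2^{\nu}}\right)\le\frac{y+1}{2}$. (e) $\xi_\nu\le\frac{y+1}{2}$. The system (MIP-D) consists of $(x,y)\in B_{[\ell,u]}$ together with (a), (b), (c), (d), (e). The system (MIP-D$^+$) consists of $(x,y)\in B_{[\ell,u]}$, $y\ge x^2$, together with (a), (b), (c). Convex regions. For an angle $\alpha\in(-\frac32\pi,\frac\pi2)$ let $x_\alpha$ be the unique real number such that $\left(x_\alpha,\frac{x_\alpha^2-1}{2}\right)=(r\cos\alpha,r\sin\alpha)$ for some $r>0$. Let $\mathcal{U}=\{(x,x^2):x\in\mathbb{R}\}$. For angles $\alpha,\beta\in(-\frac32\pi,\frac\pi2)$, $\Delta_{\alpha,\beta}$ denotes the triangular convex region formed by the two tangent lines of $\mathcal{U}$ at $(x_\alpha,x_\alpha^2)$ and $(x_\beta,x_\beta^2)$ and the secant line connecting these two points, characterized by the three inequalities $$x\cos\alpha+y\,\frac{\sin\alpha-1}{2}\le\frac{\sin\alpha+1}{2},\qquad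 x\cos\beta+y\,\frac{\sin\beta-1}{2}\le\frac{\sin\beta+1}{2},$$ $$x\cos\frac{\alpha+\beta}{2}+y\,\frac{\sin\frac{\alpha+\beta}{2}-\cos\frac{\alpha-\beta}{2}}{2}\ge\frac{\sin\frac{\alpha+\beta}{2}+\cos\frac{\alpha-\beta}{2}}{2};$$ $\Delta^+_{\alpha,\beta}$ denotes the convex region bounded by $\mathcal{U}$ and the secant line passing through $(x_\alpha,x_\alpha^2)$ and $(x_\beta,x_\beta^2)$, characterized by the last of these three inequalities together with $y\ge x^2$.
   Formalization: In the first equivalence, membership in Δ is supplemented by y ≥ 0 and, when ℓ = u, by x = ℓ: the triangle can dip below y = 0 when ℓ < 0 < u (ℓ=-1/3, u=3, ν=1, z=0, point (1/12,-1/6)), and for ℓ = u its inequalities describe a whole line. *)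

(* Defs.v *)
From Stdlib Require Import Reals List.
Open Scope R_scope.

(* Families indexed by 1..nu are functions on nat; indices outside 1..nu do not
   enter any constraint. A binary variable z_j is a bool, with value [bin (z j)]. *)
Definition bin (b : bool) : R := INR (Nat.b2n b).

Definition B_region (l u x y : R) : Prop :=
  l <= x <= u /\ 0 <= y <= (l + u) * x - l * u.

Definition Theta (t : R) : R :=
  match total_order_T t 0 with
  | inleft (left _) => atan ((t ^ 2 - 1) / (2 * t)) - PI
  | inleft (right _) => - (PI / 2)
  | inright _ => atan ((t ^ 2 - 1) / (2 * t))
  end.

Definition theta_min (l : R) : R := Theta l.
Definition theta_max (u : R) : R := Theta u.
Definition theta_mid (l u : R) : R := (theta_min l + theta_max u) / 2.
Definition theta_d (l u : R) : R := theta_max u - theta_min l.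

Definition Cbound (l u : R) : R := Rmax (l ^ 2) (u ^ 2) / 2 + 1 / 2.

Definition Cj (l u : R) (j : nat) : R :=
  Cbound l u * sin (theta_d l u / 2 ^ (j + 1)).

Definition lambda_bounds (lam1 lam2 : nat -> R) (z : nat -> bool) (j : nat) : Prop :=
  0 <= lam1 j <= 1 - bin (z j) /\ 0 <= lam2 j <= bin (z j).

Definition constr_a (l u x y : R) (xi eta lam1 lam2 : nat -> R)
    (z : nat -> bool) : Prop :=
  xi 1%nat = x * cos (theta_mid l u) + (y / 2 - 1 / 2) * sin (theta_mid l u) /\
  (lam2 1%nat - lam1 1%nat) * Cbound l u =
    - x * sin (theta_mid l u) + (y / 2 - 1 / 2) * cos (theta_mid l u) /\
  eta 1%nat = (lam1 1%nat + lam2 1%nat) * Cbound l u /\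
  lambda_bounds lam1 lam2 z 1.

Definition constr_b (l u : R) (nu : nat) (xi eta lam1 lam2 : nat -> R)
    (z : nat -> bool) : Prop :=
  forall j : nat, (1 <= j <= nu - 1)%nat ->
    let t := theta_d l u / 2 ^ (j + 1) in
    xi (j + 1)%nat = xi j * cos t + eta j * sin t /\
    (lam2 (j + 1)%nat - lam1 (j + 1)%nat) * Cj l u j =
      - xi j * sin t + eta j * cos t /\
    eta (j + 1)%nat = (lam1 (j + 1)%nat + lam2 (j + 1)%nat) * Cj l u j /\
    lambda_bounds lam1 lam2 z (j + 1).

Definition constr_c (l u : R) (nu : nat) (y : R) (xi eta : nat -> R) : Prop :=
  let t := theta_d l u / 2 ^ (nu + 1) in
  xi nu * cos t + eta nu * sin t >= (y + 1) / 2 * cos t.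

Definition constr_d (l u : R) (nu : nat) (y : R) (xi eta : nat -> R) : Prop :=
  let t := theta_d l u / 2 ^ nu in
  xi nu * cos t + eta nu * sin t <= (y + 1) / 2.

Definition constr_e (nu : nat) (y : R) (xi : nat -> R) : Prop :=
  xi nu <= (y + 1) / 2.

Definition MIP_D (l u : R) (nu : nat) (x y : R) (xi eta lam1 lam2 : nat -> R)
    (z : nat -> bool) : Prop :=
  B_region l u x y /\
  constr_a l u x y xi eta lam1 lam2 z /\
  constr_b l u nu xi eta lam1 lam2 z /\
  constr_c l u nu y xi eta /\
  constr_d l u nu y xi eta /\
  constr_e nu y xi.

Definition MIP_Dplus (l u : R) (nu : nat) (x y : R) (xi eta lam1 lam2 : nat -> R)
    (z : nat -> bool) : Prop :=
  B_region l u x y /\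
  y >= x ^ 2 /\
  constr_a l u x y xi eta lam1 lam2 z /\
  constr_b l u nu xi eta lam1 lam2 z /\
  constr_c l u nu y xi eta.

Definition above_tangent (a x y : R) : Prop :=
  x * cos a + y * ((sin a - 1) / 2) <= (sin a + 1) / 2.

Definition below_secant (a b x y : R) : Prop :=
  x * cos ((a + b) / 2) + y * ((sin ((a + b) / 2) - cos ((a - b) / 2)) / 2)
    >= (sin ((a + b) / 2) + cos ((a - b) / 2)) / 2.

(* For a = b these three inequalities describe the whole tangent line, whereas
   the triangle they stand for shrinks to its point of tangency. *)
Definition Delta_region (a b x y : R) : Prop :=
  above_tangent a x y /\ above_tangent b x y /\ below_secant a b x y.

Definition Delta_plus_region (a b x y : R) : Prop :=
  below_secant a b x y /\ y >= x ^ 2.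

Definition count_zeros (z : nat -> bool) (i : nat) : nat :=
  list_sum (map (fun j => (1 - Nat.b2n (z j))%nat) (seq 1 i)).

(* [sum_f_R0 f n] includes the index n. *)
Definition phi_z (l u : R) (nu : nat) (z : nat -> bool) : R :=
  theta_min l +
  sum_f_R0 (fun i => (-1) ^ count_zeros z i * (theta_d l u / 2 ^ (i + 1))) (nu - 1).

Definition beta_z (l u : R) (nu : nat) (z : nat -> bool) : R :=
  phi_z l u nu z + (-1) ^ count_zeros z nu * (theta_d l u / 2 ^ nu).

(* Main.v *)
(* Put A = (x, (y-1)/2), W = (y+1)/2 and e(g) = (cos g, sin g). The tangent at
   angle a reads A.e(a) <= W, and the secant through the points at angles a, b reads
   A.e((a+b)/2) >= W cos((a-b)/2). Constraints (a), (b) rotate A and reflect it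
   according to z: (xi_j, eta_j) are the coordinates of A in the frame at angle
   phi_j, oriented by (-1)^(number of zeros among z_1, ..., z_j), so (c), (d), (e)
   are literally the three inequalities of Delta. What remains is that a point of
   Delta lies in B and has 0 <= eta_1 <= C and 0 <= eta_(j+1) <= C_j. Since
   Theta(t) = 2 atan t - PI/2, Delta is the triangle with vertices
   ((tan p + tan q)/2, tan p tan q), for p, q among its two half-angles; affine
   inequalities need only be checked there, where the transverse coordinate at angle
   2g - PI/2 is sin(p + q - 2g) / (2 cos p cos q). *)
Require Import Defs.
From Stdlib Require Import Reals List.
From Stdlib Require Import Lra Lia Psatz.
Open Scope R_scope.

(** * Rotating frames and the coordinates forced by (a) and (b) *)

Definition radial (x y a : R) : R := x * cos a + (y / 2 - 1 / 2) * sin a.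

Definition transverse (x y a : R) : R := - x * sin a + (y / 2 - 1 / 2) * cos a.

Definition orient (z : nat -> bool) (j : nat) : R := (-1) ^ count_zeros z j.

Lemma orient_cases (z : nat -> bool) (j : nat) : orient z j = 1 \/ orient z j = -1.
Proof.
  unfold orient. induction (count_zeros z j) as [|n IH]; simpl; [now left|].
  destruct IH as [-> | ->]; [right | left]; ring.
Qed.

Lemma count_zeros_succ (z : nat -> bool) (j : nat) :
  count_zeros z (j + 1) = (count_zeros z j + (1 - Nat.b2n (z (j + 1)%nat)))%nat.
Proof.
  unfold count_zeros.
  replace (j + 1)%nat with (S j) by lia.
  rewrite seq_S, map_app, list_sum_app; simpl. lia.
Qed.

Lemma orient_succ (z : nat -> bool) (j : nat) :
  orient z (j + 1) = orient z j * (if z (j + 1)%nat then 1 else -1).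
Proof.
  unfold orient. rewrite count_zeros_succ, pow_add.
  destruct (z (j + 1)%nat); simpl; ring.
Qed.

Lemma orient_one (z : nat -> bool) : orient z 1 = if z 1%nat then 1 else -1.
Proof.
  unfold orient, count_zeros; simpl. destruct (z 1%nat); simpl; ring.
Qed.

Lemma phi_z_one (l u : R) (z : nat -> bool) : phi_z l u 1 z = theta_mid l u.
Proof.
  unfold phi_z, theta_mid, theta_d, count_zeros; simpl. field.
Qed.

Lemma phi_z_succ (l u : R) (z : nat -> bool) (j : nat) : (1 <= j)%nat ->
  phi_z l u (j + 1) z = phi_z l u j z + orient z j * (theta_d l u / 2 ^ (j + 1)).
Proof.
  intros Hj. unfold phi_z, orient.
  replace (j + 1 - 1)%nat with (S (j - 1)) by lia.
  rewrite tech5. replace (S (j - 1)) with j by lia. ring.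
Qed.

(** In a frame reflected by [s], turning by [s * t] looks like turning by [t]. This is why (b) can
    use the same rotation whatever the earlier binaries are. *)
Lemma radial_rotate (x y a s t : R) : s = 1 \/ s = -1 ->
  radial x y (a + s * t) = radial x y a * cos t + s * transverse x y a * sin t.
Proof.
  unfold radial, transverse. rewrite cos_plus, sin_plus.
  intros [-> | ->].
  - rewrite !Rmult_1_l. ring.
  - replace (-1 * t) with (- t) by ring. rewrite cos_neg, sin_neg. ring.
Qed.

Lemma transverse_rotate (x y a s t : R) : s = 1 \/ s = -1 ->
  s * transverse x y (a + s * t) = - radial x y a * sin t + s * transverse x y a * cos t.
Proof.
  unfold radial, transverse. rewrite cos_plus, sin_plus.
  intros [-> | ->].
  - rewrite !Rmult_1_l. ring.
  - replace (-1 * t) with (- t) by ring. rewrite cos_neg, sin_neg. ring.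
Qed.

(** The binary kills one of the two multipliers, so their sum is plus or minus their difference:
    [z j] decides whether to reflect. *)
Lemma lambda_bounds_sum (lam1 lam2 : nat -> R) (z : nat -> bool) (j : nat) (K : R) :
  lambda_bounds lam1 lam2 z j ->
  (lam1 j + lam2 j) * K = (if z j then 1 else -1) * ((lam2 j - lam1 j) * K).
Proof.
  unfold lambda_bounds, bin. destruct (z j); simpl; intros [H1 H2].
  - replace (lam1 j) with 0 by lra. ring.
  - replace (lam2 j) with 0 by lra. ring.
Qed.

Lemma frame_coordinates (l u x y : R) (nu : nat) (xi eta lam1 lam2 : nat -> R)
    (z : nat -> bool) :
  constr_a l u x y xi eta lam1 lam2 z ->
  constr_b l u nu xi eta lam1 lam2 z ->
  forall j : nat, (1 <= j <= nu)%nat ->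
    xi j = radial x y (phi_z l u j z) /\
    eta j = orient z j * transverse x y (phi_z l u j z).
Proof.
  intros (Ha1 & Ha2 & Ha3 & Ha4) Hb j.
  induction j as [|j IH]; [lia|]. intros Hj.
  destruct (Nat.eq_dec j 0) as [-> | Hj0].
  - rewrite phi_z_one, orient_one. split; [exact Ha1|].
    rewrite Ha3, (lambda_bounds_sum _ _ _ _ _ Ha4), Ha2. reflexivity.
  - destruct IH as [IH1 IH2]; [lia|].
    destruct (Hb j) as (Hb1 & Hb2 & Hb3 & Hb4); [lia|].
    replace (S j) with (j + 1)%nat by lia.
    rewrite phi_z_succ, orient_succ by lia.
    rewrite Hb3, (lambda_bounds_sum _ _ _ _ _ Hb4), Hb2, Hb1, IH1, IH2.
    split.
    + symmetry. apply radial_rotate, orient_cases.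
    + rewrite <- transverse_rotate by apply orient_cases. ring.
Qed.

(** * Constraints (c), (d), (e) as secant and tangent inequalities *)

Lemma constr_c_iff (l u x y : R) (nu : nat) (xi eta : nat -> R) (z : nat -> bool) :
  xi nu = radial x y (phi_z l u nu z) ->
  eta nu = orient z nu * transverse x y (phi_z l u nu z) ->
  constr_c l u nu y xi eta <->
  below_secant (phi_z l u nu z) (beta_z l u nu z) x y.
Proof.
  intros H1 H2. unfold constr_c, below_secant. rewrite H1, H2.
  set (t := theta_d l u / 2 ^ (nu + 1)).
  assert (Hw : theta_d l u / 2 ^ nu = 2 * t)
    by (unfold t; rewrite pow_add; field; apply pow_nonzero; lra).
  rewrite <- radial_rotate by apply orient_cases.
  unfold beta_z. fold (orient z nu). rewrite Hw.
  set (f := phi_z l u nu z).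
  (* [beta_z] is [f] turned by [2 * t] up to sign, so the secant direction is [f] turned by [t], and
     evenness of cosine removes the sign from the half-difference. *)
  replace ((f + (f + orient z nu * (2 * t))) / 2) with (f + orient z nu * t) by field.
  replace ((f - (f + orient z nu * (2 * t))) / 2) with (- (orient z nu * t)) by field.
  rewrite cos_neg.
  replace (cos (orient z nu * t)) with (cos t)
    by (destruct (orient_cases z nu) as [-> | ->];
        [now rewrite Rmult_1_l | rewrite <- cos_neg; f_equal; ring]).
  unfold radial. split; lra.
Qed.

Lemma above_tangent_radial (a x y : R) :
  above_tangent a x y <-> radial x y a <= (y + 1) / 2.
Proof. unfold above_tangent, radial. split; lra. Qed.

Lemma constr_d_iff (l u x y : R) (nu : nat) (xi eta : nat -> R) (z : nat -> bool) :
  xi nu = radial x y (phi_z l u nu z) ->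
  eta nu = orient z nu * transverse x y (phi_z l u nu z) ->
  constr_d l u nu y xi eta <-> above_tangent (beta_z l u nu z) x y.
Proof.
  intros H1 H2. unfold constr_d. rewrite H1, H2.
  rewrite <- radial_rotate by apply orient_cases.
  symmetry. apply above_tangent_radial.
Qed.

Lemma constr_e_iff (l u x y : R) (nu : nat) (xi : nat -> R) (z : nat -> bool) :
  xi nu = radial x y (phi_z l u nu z) ->
  constr_e nu y xi <-> above_tangent (phi_z l u nu z) x y.
Proof.
  intros H1. unfold constr_e. rewrite H1. symmetry. apply above_tangent_radial.
Qed.

(** * Recovering the multipliers from bounded coordinates *)

Lemma Cbound_pos (l u : R) : 0 < Cbound l u.
Proof.
  unfold Cbound. pose proof (Rmax_l (l ^ 2) (u ^ 2)). nra.
Qed.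

(* When [K = 0] the bounds force [c = 0], so the quotient [c / K] is still [0]. *)
Lemma frame_scale (c K : R) : 0 <= c <= K -> 0 <= c / K <= 1 /\ c / K * K = c.
Proof.
  intros Hc. destruct (Req_dec K 0) as [-> | HK].
  - replace c with 0 by lra. unfold Rdiv. rewrite Rmult_0_l. lra.
  - split; [|field; exact HK].
    assert (E : c / K * K = c) by (field; exact HK).
    split; apply (Rmult_le_reg_r K); lra.
Qed.

Lemma frame_feasible (l u x y : R) (nu : nat) (z : nat -> bool) :
  (1 <= nu)%nat ->
  0 <= orient z 1 * transverse x y (phi_z l u 1 z) <= Cbound l u ->
  (forall j : nat, (1 <= j <= nu - 1)%nat ->
     0 <= orient z (j + 1) * transverse x y (phi_z l u (j + 1) z) <= Cj l u j) ->
  exists xi eta lam1 lam2 : nat -> R,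
    constr_a l u x y xi eta lam1 lam2 z /\
    constr_b l u nu xi eta lam1 lam2 z.
Proof.
  intros Hnu H1 Hj.
  set (eta := fun j : nat => orient z j * transverse x y (phi_z l u j z)).
  (* [r j] is the multiplier that [z j] allows to be nonzero. The scale at index [j + 1] is
     [Cj l u j], hence the shift [j - 1]; index 1 uses [Cbound]. *)
  set (r := fun j : nat =>
              eta j / (if Nat.eqb j 1 then Cbound l u else Cj l u (j - 1))).
  exists (fun j => radial x y (phi_z l u j z)), eta,
    (fun j => if z j then 0 else r j), (fun j => if z j then r j else 0).
  split.
  - destruct (frame_scale _ _ H1) as [Hr HrC].
    change (0 <= r 1%nat <= 1) in Hr.
    change (r 1%nat * Cbound l u = eta 1%nat) in HrC.
    assert (E : eta 1%nat = (if z 1%nat then 1 else -1) * transverse x y (theta_mid l u))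
      by (unfold eta; now rewrite orient_one, phi_z_one).
    unfold constr_a, lambda_bounds, bin. rewrite phi_z_one.
    fold (radial x y (theta_mid l u)). fold (transverse x y (theta_mid l u)).
    destruct (z 1%nat); simpl; repeat split; lra.
  - intros j Hjn t.
    destruct (frame_scale _ _ (Hj j Hjn)) as [Hr HrC].
    assert (Er : r (j + 1)%nat = eta (j + 1)%nat / Cj l u j).
    { unfold r. replace (Nat.eqb (j + 1) 1) with false
        by (symmetry; apply Nat.eqb_neq; lia).
      now replace (j + 1 - 1)%nat with j by lia. }
    fold (eta (j + 1)%nat) in Hr, HrC. rewrite <- Er in Hr, HrC.
    assert (E : eta (j + 1)%nat = (if z (j + 1)%nat then 1 else -1) *
              (- radial x y (phi_z l u j z) * sin t + eta j * cos t)).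
    { unfold eta. rewrite <- transverse_rotate by apply orient_cases.
      rewrite orient_succ, phi_z_succ by lia. unfold t. ring. }
    split.
    { rewrite phi_z_succ by lia. apply radial_rotate, orient_cases. }
    unfold lambda_bounds, bin.
    destruct (z (j + 1)%nat); simpl; repeat split; lra.
Qed.

(** * Half-angles: tangents and secants in terms of slopes *)

Lemma Theta_atan (t : R) : Theta t = 2 * atan t - PI / 2.
Proof.
  unfold Theta.
  pose proof (atan_bound t) as B. pose proof PI_RGT_0 as HPI.
  assert (Hc : 0 < cos (atan t)) by (apply cos_gt_0; lra).
  assert (Ht : sin (atan t) = t * cos (atan t)).
  { rewrite <- (tan_atan t) at 2. unfold tan. field. lra. }
  pose proof (sin2_cos2 (atan t)) as Hsc. unfold Rsqr in Hsc.
  assert (Hcc : cos (atan t) * cos (atan t) * (1 + t * t) = 1)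
    by (rewrite Ht in Hsc; lra).
  (* The quotient is the tangent of [2 * atan t] shifted by [PI / 2]: upwards for [s = 1], downwards
     for [s = -1]. The sign of [t] decides which shift lands in the range of [atan]. *)
  assert (Htan : forall s : R, s = 1 \/ s = -1 -> t <> 0 ->
    s * cos (2 * atan t) / (s * - sin (2 * atan t)) = (t ^ 2 - 1) / (2 * t)).
  { intros s Hs H0. rewrite cos_2a, sin_2a, Ht.
    destruct Hs as [-> | ->]; field; split; try lra; nra. }
  destruct (total_order_T t 0) as [[H|H]|H].
  - assert (A : atan t < 0) by (rewrite <- atan_0; now apply atan_increasing).
    rewrite <- (Htan 1) by lra.
    replace (1 * cos (2 * atan t) / (1 * - sin (2 * atan t)))
      with (tan (PI / 2 + 2 * atan t)).
    + rewrite atan_tan; lra.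
    + unfold tan. rewrite <- cos_sin.
      replace (cos (PI / 2 + 2 * atan t)) with (- sin (2 * atan t))
        by (rewrite sin_cos; ring).
      now rewrite !Rmult_1_l.
  - rewrite H, atan_0. lra.
  - assert (A : 0 < atan t) by (rewrite <- atan_0; now apply atan_increasing).
    rewrite <- (Htan (-1)) by lra.
    replace (-1 * cos (2 * atan t) / (-1 * - sin (2 * atan t)))
      with (tan (2 * atan t - PI / 2)).
    + rewrite atan_tan; lra.
    + unfold tan. rewrite sin_minus, cos_minus, cos_PI2, sin_PI2.
      f_equal; ring.
Qed.

Lemma sin_cos_half (p : R) :
  sin (2 * p - PI / 2) = 1 - 2 * cos p * cos p /\
  cos (2 * p - PI / 2) = 2 * sin p * cos p.
Proof.
  rewrite sin_minus, cos_minus, cos_PI2, sin_PI2, cos_2a_cos, sin_2a.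
  split; ring.
Qed.

(** The parabola point at angle [2 * p - PI / 2] has abscissa [tan p]; the two slacks differ by the
    positive factor [cos p * cos p]. *)
Lemma above_tangent_slope (p x y : R) : 0 < cos p ->
  above_tangent (2 * p - PI / 2) x y <-> 2 * tan p * x - tan p ^ 2 <= y.
Proof.
  intros Hc. unfold above_tangent. destruct (sin_cos_half p) as [-> ->].
  assert (Hs : sin p = tan p * cos p) by (unfold tan; field; lra).
  pose proof (sin2_cos2 p) as E. unfold Rsqr in E.
  assert (Hcc : 0 < cos p * cos p) by nra.
  rewrite Hs in *. set (a := tan p) in *. set (c := cos p) in *. clearbody a c.
  assert (I : (1 - 2 * c * c + 1) / 2
              - (x * (2 * (a * c) * c) + y * ((1 - 2 * c * c - 1) / 2))
              = (c * c) * (y - (2 * a * x - a ^ 2))) by lra.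
  split; intros H; nra.
Qed.

Lemma below_secant_slope (p q x y : R) : 0 < cos p -> 0 < cos q ->
  below_secant (2 * p - PI / 2) (2 * q - PI / 2) x y <->
  y <= (tan p + tan q) * x - tan p * tan q.
Proof.
  intros Hp Hq. unfold below_secant.
  replace ((2 * p - PI / 2 + (2 * q - PI / 2)) / 2) with (p + q - PI / 2) by field.
  replace ((2 * p - PI / 2 - (2 * q - PI / 2)) / 2) with (p - q) by field.
  rewrite sin_minus, !cos_minus, cos_PI2, sin_PI2, cos_plus, sin_plus.
  assert (Hsp : sin p = tan p * cos p) by (unfold tan; field; lra).
  assert (Hsq : sin q = tan q * cos q) by (unfold tan; field; lra).
  rewrite Hsp, Hsq.
  assert (H : 0 < cos p * cos q) by nra.
  set (a := tan p) in *. set (b := tan q) in *.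
  set (c := cos p) in *. set (d := cos q) in *. clearbody a b c d.
  split; intros G; nra.
Qed.

(** * Affine bounds checked at the vertices of the triangle *)

Lemma transverse_vertex (p q g : R) : cos p <> 0 -> cos q <> 0 ->
  transverse ((tan p + tan q) / 2) (tan p * tan q) g =
  sin (p + q - PI / 2 - g) / (2 * cos p * cos q).
Proof.
  (* At this vertex, [(x, (y - 1) / 2)] is the unit vector at angle [p + q - PI / 2] divided by
     [2 * cos p * cos q]. *)
  intros Hp Hq. unfold transverse, tan.
  replace (p + q - PI / 2 - g) with ((p + q - g) - PI / 2) by ring.
  rewrite sin_minus, cos_PI2, sin_PI2, cos_minus, cos_plus, sin_plus.
  field. split; assumption.
Qed.

(* [(b - a)^2 f(x,y)] is the combination of the vertex values of [f] weighted by
   the slacks of the three inequalities. *)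
Lemma triangle_affine (a b x y k0 k1 k2 : R) :
  2 * a * x - a ^ 2 <= y -> 2 * b * x - b ^ 2 <= y ->
  y <= (a + b) * x - a * b -> (a = b -> x = a) ->
  0 <= k0 + k1 * ((a + a) / 2) + k2 * (a * a) ->
  0 <= k0 + k1 * ((b + b) / 2) + k2 * (b * b) ->
  0 <= k0 + k1 * ((a + b) / 2) + k2 * (a * b) ->
  0 <= k0 + k1 * x + k2 * y.
Proof.
  intros Ta Tb S Hab Fa Fb Fab.
  destruct (Req_dec a b) as [E | N].
  - rewrite (Hab E) in *. subst b.
    replace y with (a * a) by lra. lra.
  - assert (P : 0 < (b - a) ^ 2) by (assert (b - a <> 0) by lra; nra).
    apply (Rmult_le_reg_l ((b - a) ^ 2)); [exact P|].
    rewrite Rmult_0_r.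
    replace ((b - a) ^ 2 * (k0 + k1 * x + k2 * y)) with
      ((y - (2 * b * x - b ^ 2)) * (k0 + k1 * ((a + a) / 2) + k2 * (a * a)) +
       (y - (2 * a * x - a ^ 2)) * (k0 + k1 * ((b + b) / 2) + k2 * (b * b)) +
       2 * ((a + b) * x - a * b - y) * (k0 + k1 * ((a + b) / 2) + k2 * (a * b)))
      by field.
    repeat apply Rplus_le_le_0_compat; repeat apply Rmult_le_pos; lra.
Qed.

Lemma half_angle_slope (l u p : R) : atan l <= p <= atan u ->
  0 < cos p /\ l <= tan p <= u.
Proof.
  intros [H1 H2]. pose proof (atan_bound l). pose proof (atan_bound u).
  split; [apply cos_gt_0; lra|].
  assert (E : atan (tan p) = p) by (apply atan_tan; lra).
  rewrite <- E in H1, H2.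
  split; apply Rnot_lt_le; intros G; apply atan_increasing in G; lra.
Qed.

Lemma tan_half_angle_inj (l u p q : R) :
  atan l <= p <= atan u -> atan l <= q <= atan u -> tan p = tan q -> p = q.
Proof.
  intros Hp Hq E. pose proof (atan_bound l). pose proof (atan_bound u).
  rewrite <- (atan_tan p), <- (atan_tan q) by lra. now rewrite E.
Qed.

(** Since [1 / cos^2 = 1 + tan^2], each squared inverse cosine is at most [2 * Cbound l u]; the
    mixed product follows from the arithmetic-geometric mean inequality. *)
Lemma inv_cos_bound (l u p q : R) :
  atan l <= p <= atan u -> atan l <= q <= atan u ->
  / (2 * cos p * cos q) <= Cbound l u.
Proof.
  intros Hp Hq.
  assert (B : forall r, atan l <= r <= atan u -> (/ cos r) ^ 2 <= 2 * Cbound l u).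
  { intros r Hr. destruct (half_angle_slope _ _ _ Hr) as [Hc Ht].
    pose proof (sin2_cos2 r) as E. unfold Rsqr in E.
    assert (F : (/ cos r) ^ 2 = 1 + tan r ^ 2).
    { replace ((/ cos r) ^ 2) with ((sin r * sin r + cos r * cos r) * (/ cos r) ^ 2)
        by (rewrite E; ring).
      unfold tan. field. lra. }
    rewrite F. unfold Cbound.
    pose proof (Rmax_l (l ^ 2) (u ^ 2)). pose proof (Rmax_r (l ^ 2) (u ^ 2)).
    assert (tan r ^ 2 <= Rmax (l ^ 2) (u ^ 2)).
    { destruct (Rle_dec 0 (tan r)); nra. }
    lra. }
  destruct (half_angle_slope _ _ _ Hp) as [Hcp _].
  destruct (half_angle_slope _ _ _ Hq) as [Hcq _].
  replace (/ (2 * cos p * cos q)) with (/ cos p * / cos q / 2) by (field; lra).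
  pose proof (B p Hp). pose proof (B q Hq).
  pose proof (pow2_ge_0 (/ cos p - / cos q)). nra.
Qed.

Lemma sin_pm (s t : R) : s = 1 \/ s = -1 -> sin (s * t) = s * sin t.
Proof.
  intros [-> | ->]; [now rewrite !Rmult_1_l|].
  replace (-1 * t) with (- t) by ring. rewrite sin_neg. ring.
Qed.

(** [M] is left free to cover both scales: 1 gives [Cbound], and the sine of the sector width gives
    [Cj]. *)
Lemma transverse_vertex_bounds (l u p q g s w M : R) :
  atan l <= p <= atan u -> atan l <= q <= atan u ->
  s = 1 \/ s = -1 -> w <= PI -> 0 <= M ->
  (forall t : R, 0 <= t <= w -> sin t <= M) ->
  0 <= s * (p + q - PI / 2 - g) <= w ->
  0 <= s * transverse ((tan p + tan q) / 2) (tan p * tan q) g <= Cbound l u * M.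
Proof.
  intros Hp Hq Hs Hw HM Hsin Ht.
  destruct (half_angle_slope _ _ _ Hp) as [Hcp _].
  destruct (half_angle_slope _ _ _ Hq) as [Hcq _].
  rewrite transverse_vertex by lra.
  unfold Rdiv. rewrite <- Rmult_assoc, <- sin_pm by exact Hs.
  pose proof (inv_cos_bound _ _ _ _ Hp Hq) as HC.
  assert (Hi : 0 < / (2 * cos p * cos q)) by (apply Rinv_0_lt_compat; nra).
  assert (H0 : 0 <= sin (s * (p + q - PI * / 2 - g))) by (apply sin_ge_0; lra).
  pose proof (Hsin _ Ht) as H1. unfold Rdiv in H1.
  split; [nra|].
  rewrite Rmult_comm. apply Rmult_le_compat; lra.
Qed.

Lemma transverse_bounds (l u p q x y g s w M : R) :
  atan l <= p <= atan u -> atan l <= q <= atan u ->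
  2 * tan p * x - tan p ^ 2 <= y -> 2 * tan q * x - tan q ^ 2 <= y ->
  y <= (tan p + tan q) * x - tan p * tan q -> (tan p = tan q -> x = tan p) ->
  s = 1 \/ s = -1 -> w <= PI -> 0 <= M ->
  (forall t : R, 0 <= t <= w -> sin t <= M) ->
  0 <= s * (2 * p - PI / 2 - g) <= w ->
  0 <= s * (2 * q - PI / 2 - g) <= w ->
  0 <= s * transverse x y g <= Cbound l u * M.
Proof.
  intros Hp Hq Tp Tq S E Hs Hw HM Hsin Gp Gq.
  assert (V : forall p' q', atan l <= p' <= atan u -> atan l <= q' <= atan u ->
    0 <= s * (p' + q' - PI / 2 - g) <= w ->
    0 <= s * transverse ((tan p' + tan q') / 2) (tan p' * tan q') g <= Cbound l u * M)
    by (intros; now apply transverse_vertex_bounds with (w := w)).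
  assert (Vp := V p p Hp Hp ltac:(lra)).
  assert (Vq := V q q Hq Hq ltac:(lra)).
  (* [p + q] is the mean of [2 * p] and [2 * q], so its angle obeys the same bounds. *)
  assert (Vpq := V p q Hp Hq ltac:(lra)).
  unfold transverse in *.
  pose proof (triangle_affine _ _ _ _ (- s * cos g / 2) (- s * sin g) (s * cos g / 2)
    Tp Tq S E ltac:(lra) ltac:(lra) ltac:(lra)).
  pose proof (triangle_affine _ _ _ _ (Cbound l u * M + s * cos g / 2)
    (s * sin g) (- s * cos g / 2) Tp Tq S E ltac:(lra) ltac:(lra) ltac:(lra)).
  lra.
Qed.

Lemma triangle_B_region (l u a b x y : R) :
  l <= a <= u -> l <= b <= u ->
  2 * a * x - a ^ 2 <= y -> 2 * b * x - b ^ 2 <= y ->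
  y <= (a + b) * x - a * b -> (a = b -> x = a) ->
  0 <= y -> B_region l u x y.
Proof.
  intros Ha Hb Ta Tb S E Hy.
  pose proof (triangle_affine _ _ _ _ (- l) 1 0 Ta Tb S E
    ltac:(lra) ltac:(lra) ltac:(lra)).
  pose proof (triangle_affine _ _ _ _ u (-1) 0 Ta Tb S E
    ltac:(lra) ltac:(lra) ltac:(lra)).
  (* At the vertex of slopes [a], [b] the value is [((u - a) * (b - l) + (a - l) * (u - b)) / 2]. *)
  pose proof (triangle_affine _ _ _ _ (- l * u) (l + u) (-1) Ta Tb S E
    ltac:(nra) ltac:(nra) ltac:(nra)).
  unfold B_region. lra.
Qed.

(** * Nested angular sectors selected by the binaries *)

Definition in_sector (l u : R) (z : nat -> bool) (j : nat) (a : R) : Prop :=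
  0 <= orient z j * (a - phi_z l u j z) <= theta_d l u / 2 ^ j.

Lemma theta_d_bounds (l u : R) : l <= u -> 0 <= theta_d l u < 2 * PI.
Proof.
  intros H. unfold theta_d, theta_max, theta_min. rewrite !Theta_atan.
  pose proof (atan_bound l). pose proof (atan_bound u).
  destruct (Req_dec l u) as [-> | N]; [lra|].
  assert (atan l < atan u) by (apply atan_increasing; lra). lra.
Qed.

Lemma width_nonneg (l u : R) (j : nat) : l <= u -> 0 <= theta_d l u / 2 ^ j.
Proof.
  intros H. pose proof (theta_d_bounds l u H).
  apply Rmult_le_pos; [lra|]. apply Rlt_le, Rinv_0_lt_compat, pow_lt; lra.
Qed.

Lemma width_halve (l u : R) (j : nat) :
  theta_d l u / 2 ^ (j + 1) = theta_d l u / 2 ^ j / 2.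
Proof. rewrite pow_add. field. apply pow_nonzero. lra. Qed.

(** The start of sector [j + 1] is the midpoint of sector [j], and its orientation selects one of
    the two halves. *)
Lemma in_sector_pred (l u : R) (z : nat -> bool) (j : nat) (a : R) :
  l <= u -> (1 <= j)%nat -> in_sector l u z (j + 1) a -> in_sector l u z j a.
Proof.
  intros Hlu Hj. unfold in_sector. rewrite phi_z_succ, width_halve by exact Hj.
  pose proof (width_nonneg l u j Hlu).
  destruct (orient_cases z j) as [-> | ->], (orient_cases z (j + 1)) as [-> | ->]; lra.
Qed.

Lemma in_sector_le (l u : R) (z : nat -> bool) (j k : nat) (a : R) :
  l <= u -> (1 <= j)%nat -> (j <= k)%nat -> in_sector l u z k a -> in_sector l u z j a.
Proof.
  intros Hlu Hj Hjk. induction Hjk as [|k Hjk IH]; [easy|].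
  intros H. apply IH, in_sector_pred; [exact Hlu | lia|].
  now replace (k + 1)%nat with (S k) by lia.
Qed.

Lemma in_sector_range (l u : R) (z : nat -> bool) (nu : nat) (a : R) :
  l <= u -> (1 <= nu)%nat -> in_sector l u z nu a -> theta_min l <= a <= theta_max u.
Proof.
  intros Hlu Hnu H. apply (in_sector_le _ _ _ 1) in H; [|auto..].
  unfold in_sector in H. rewrite phi_z_one in H. unfold theta_mid, theta_d in H.
  destruct (orient_cases z 1) as [E | E]; rewrite E in H; simpl in H; lra.
Qed.

Lemma phi_in_sector (l u : R) (z : nat -> bool) (nu : nat) :
  l <= u -> in_sector l u z nu (phi_z l u nu z).
Proof.
  intros Hlu. unfold in_sector. pose proof (width_nonneg l u nu Hlu).
  rewrite Rminus_diag, Rmult_0_r. lra.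
Qed.

Lemma beta_in_sector (l u : R) (z : nat -> bool) (nu : nat) :
  l <= u -> in_sector l u z nu (beta_z l u nu z).
Proof.
  intros Hlu. unfold in_sector, beta_z. fold (orient z nu).
  pose proof (width_nonneg l u nu Hlu).
  destruct (orient_cases z nu) as [-> | ->]; lra.
Qed.

Lemma half_angle_exists (l u a : R) : theta_min l <= a <= theta_max u ->
  exists p : R, a = 2 * p - PI / 2 /\ atan l <= p <= atan u.
Proof.
  unfold theta_min, theta_max. rewrite !Theta_atan. intros H.
  exists ((a + PI / 2) / 2). lra.
Qed.

Lemma phi_eq_beta (l u : R) (z : nat -> bool) (nu : nat) :
  phi_z l u nu z = beta_z l u nu z -> l = u.
Proof.
  unfold beta_z. fold (orient z nu). intros E.
  assert (W : theta_d l u / 2 ^ nu = 0)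
    by (destruct (orient_cases z nu) as [D | D]; rewrite D in E; lra).
  assert (D : theta_d l u = 0).
  { replace (theta_d l u) with (theta_d l u / 2 ^ nu * 2 ^ nu)
      by (field; apply pow_nonzero; lra). rewrite W. ring. }
  unfold theta_d, theta_max, theta_min in D. rewrite !Theta_atan in D.
  rewrite <- (tan_atan l), <- (tan_atan u). f_equal. lra.
Qed.

(** * From the regions back to the two systems *)

Lemma Delta_feasible (l u : R) (nu : nat) (z : nat -> bool) (x y : R) :
  l <= u -> (1 <= nu)%nat ->
  Delta_region (phi_z l u nu z) (beta_z l u nu z) x y ->
  0 <= y -> (l = u -> x = l) ->
  B_region l u x y /\
  exists xi eta lam1 lam2 : nat -> R,
    constr_a l u x y xi eta lam1 lam2 z /\
    constr_b l u nu xi eta lam1 lam2 z.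
Proof.
  intros Hlu Hnu (Tp & Tq & S) Hy Hx.
  pose proof (phi_in_sector l u z nu Hlu) as Sp.
  pose proof (beta_in_sector l u z nu Hlu) as Sq.
  destruct (half_angle_exists l u _ (in_sector_range _ _ _ _ _ Hlu Hnu Sp)) as (p & Ep & Hp).
  destruct (half_angle_exists l u _ (in_sector_range _ _ _ _ _ Hlu Hnu Sq)) as (q & Eq & Hq).
  destruct (half_angle_slope _ _ _ Hp) as [Hcp Hlp].
  destruct (half_angle_slope _ _ _ Hq) as [Hcq Hlq].
  (* Equal slopes mean a sector of width zero, hence [l = u]; then [Hx] pins the point of
     tangency. *)
  assert (E : tan p = tan q -> x = tan p).
  { intros E. apply (tan_half_angle_inj l u) in E; [|assumption..].
    assert (l = u) by (apply (phi_eq_beta l u z nu); lra).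
    rewrite Hx by assumption. lra. }
  rewrite Ep in Tp, S, Sp. rewrite Eq in Tq, S, Sq.
  apply above_tangent_slope in Tp; [|assumption].
  apply above_tangent_slope in Tq; [|assumption].
  apply below_secant_slope in S; [|assumption..].
  split; [now apply (triangle_B_region l u (tan p) (tan q))|].
  pose proof (theta_d_bounds l u Hlu) as Hd.
  apply frame_feasible; [exact Hnu| |].
  (* The first sector may be wider than [PI / 2], so the sine is bounded only by 1 here. *)
  - rewrite <- (Rmult_1_r (Cbound l u)).
    apply (transverse_bounds l u p q x y _ _ (theta_d l u / 2 ^ 1));
      try assumption; try apply orient_cases.
    + simpl. lra.
    + lra.
    + intros t _. apply SIN_bound.
    + now apply (in_sector_le l u z 1 nu).
    + now apply (in_sector_le l u z 1 nu).
  - intros j Hj. unfold Cj.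
    pose proof (width_nonneg l u (j + 1) Hlu) as Hw0.
    (* From the second sector on, the width is at most a quarter of [theta_d], so the sine increases
       on it and is largest at the full width. *)
    assert (Hw : theta_d l u / 2 ^ (j + 1) <= PI / 2).
    { assert (4 <= 2 ^ (j + 1))
        by (replace 4 with (2 ^ 2) by ring; apply Rle_pow; [lra | lia]).
      apply Rmult_le_reg_r with (2 ^ (j + 1)); [lra|].
      unfold Rdiv. rewrite Rmult_assoc, Rinv_l by lra. nra. }
    apply (transverse_bounds l u p q x y _ _ (theta_d l u / 2 ^ (j + 1)));
      try assumption; try apply orient_cases.
    + lra.
    + apply sin_ge_0; lra.
    + intros t Ht. apply sin_incr_1; lra.
    + apply (in_sector_le l u z (j + 1) nu); try assumption; lia.
    + apply (in_sector_le l u z (j + 1) nu); try assumption; lia.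
Qed.

(** The parabola lies above its tangents, by [(x - a)^2 >= 0]. When [l = u] the secant is itself a
    tangent, which leaves only the point of tangency. *)
Lemma Delta_plus_Delta (l u : R) (nu : nat) (z : nat -> bool) (x y : R) :
  l <= u -> (1 <= nu)%nat ->
  Delta_plus_region (phi_z l u nu z) (beta_z l u nu z) x y ->
  Delta_region (phi_z l u nu z) (beta_z l u nu z) x y /\ 0 <= y /\ (l = u -> x = l).
Proof.
  intros Hlu Hnu (S & Hxy).
  destruct (half_angle_exists l u _
    (in_sector_range _ _ _ _ _ Hlu Hnu (phi_in_sector l u z nu Hlu))) as (p & Ep & Hp).
  destruct (half_angle_exists l u _
    (in_sector_range _ _ _ _ _ Hlu Hnu (beta_in_sector l u z nu Hlu))) as (q & Eq & Hq).
  destruct (half_angle_slope _ _ _ Hp) as [Hcp Hlp].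
  destruct (half_angle_slope _ _ _ Hq) as [Hcq Hlq].
  unfold Delta_region. rewrite Ep, Eq in *.
  rewrite !above_tangent_slope by assumption.
  pose proof (proj1 (below_secant_slope p q x y Hcp Hcq) S).
  pose proof (pow2_ge_0 (x - tan p)). pose proof (pow2_ge_0 (x - tan q)).
  repeat split; try lra; try assumption.
  - nra.
  - intros E. replace (tan p) with l in * by lra. replace (tan q) with l in * by lra.
    nra.
Qed.

(* The conjunct [0 <= y /\ (l = u -> x = l)] holds for every feasible (x, y), but
   does not follow from membership in Delta_region when l < 0 < u (the triangle can dip
   below y = 0, which B_region forbids) or when l = u (Delta_region is a whole line). *)
Theorem theorem2 (l u : R) (Hlu : l <= u) (nu : nat) (Hnu : (1 <= nu)%nat)
    (z : nat -> bool) (x y : R) :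
  ((exists xi eta lam1 lam2 : nat -> R,
      MIP_D l u nu x y xi eta lam1 lam2 z) <->
   (Delta_region (phi_z l u nu z) (beta_z l u nu z) x y /\ 0 <= y /\ (l = u -> x = l)))
  /\
  ((exists xi eta lam1 lam2 : nat -> R,
      MIP_Dplus l u nu x y xi eta lam1 lam2 z) <->
   Delta_plus_region (phi_z l u nu z) (beta_z l u nu z) x y).
Proof.
  split; split.
  - intros (xi & eta & lam1 & lam2 & HB & Ha & Hb & Hc & Hd & He).
    destruct (frame_coordinates _ _ _ _ _ _ _ _ _ _ Ha Hb nu ltac:(lia)) as [Hxi Heta].
    destruct HB as [HBx HBy].
    split; [|split; [lra | intros; lra]].
    repeat split.
    + now apply (constr_e_iff l u x y nu xi).
    + now apply (constr_d_iff l u x y nu xi eta).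
    + now apply (constr_c_iff l u x y nu xi eta).
  - intros (HD & Hy & Hx).
    destruct (Delta_feasible l u nu z x y) as (HB & xi & eta & lam1 & lam2 & Ha & Hb);
      [assumption..|].
    exists xi, eta, lam1, lam2.
    (* Whatever the witnesses, (a) and (b) force [xi nu] and [eta nu], so the remaining constraints
       can be read off the region. *)
    destruct (frame_coordinates _ _ _ _ _ _ _ _ _ _ Ha Hb nu ltac:(lia)) as [Hxi Heta].
    destruct HD as (Tp & Tq & S).
    split; [exact HB|]. repeat (split; [assumption|]). repeat split.
    + now apply (constr_c_iff l u x y nu xi eta z).
    + now apply (constr_d_iff l u x y nu xi eta z).
    + now apply (constr_e_iff l u x y nu xi z).
  - intros (xi & eta & lam1 & lam2 & HB & Hxy & Ha & Hb & Hc).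
    destruct (frame_coordinates _ _ _ _ _ _ _ _ _ _ Ha Hb nu ltac:(lia)) as [Hxi Heta].
    split; [|exact Hxy].
    now apply (constr_c_iff l u x y nu xi eta).
  - intros HD.
    destruct (Delta_plus_Delta l u nu z x y) as (HD' & Hy & Hx); [assumption..|].
    destruct (Delta_feasible l u nu z x y) as (HB & xi & eta & lam1 & lam2 & Ha & Hb);
      [assumption..|].
    exists xi, eta, lam1, lam2.
    destruct (frame_coordinates _ _ _ _ _ _ _ _ _ _ Ha Hb nu ltac:(lia)) as [Hxi Heta].
    destruct HD as (S & Hxy).
    split; [exact HB|]. split; [exact Hxy|]. repeat (split; [assumption|]).
    now apply (constr_c_iff l u x y nu xi eta z).
Qed.
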